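(* There exists a family of graphs such that the following holds. Let $\varepsilon\in(0,\frac{1}{20})$ and $\delta\in[0,\frac{1}{100})$. Every noninteractive $(\varepsilon,\delta)$-locally edge differentially private (LEDP) algorithm that gets an $n$-node graph from the family as input and approximates the number of triangles in the graph within additive error $\alpha$ with probability at least $1-\frac{1}{3^6\cdot 2^{7}}$ must have $\alpha=\Omega(n^2)$.
   Context: Differential privacy: for $\varepsilon>0$, $\delta\in[0,1)$, a randomized algorithm $\mathcal{A}$ is $(\varepsilon,\delta)$-DP with respect to a neighbor relation if for all neighboring inputs $X,X'$ and all output events $S$, $\Pr[\mathcal{A}(X)\in S]\le e^{\varepsilon}\Pr[\mathcal{A}(X')\in S]+\delta$. Two graphs on the same vertex set are edge-neighboring if their edge sets differ in exactly one edge. Local edge model: the input is an undirected graph $G=([n],E)$ with adjacency matrix $A$; node (party) $i$ holds only its row $\mathbf{a}_{i*}\in\{0,1\}^n$. An $(\varepsilon,\delta)$-local randomizer is a randomized map $R:\{0,1\}^n\to\mathcal{Y}$ such that $\Pr[R(\mathbf{a})\in Y]\le e^{\varepsilon}\Pr[R(\mathbf{a}')\in Y]+\delta$ for all $\mathbf{a},\mathbf{a}'$ differing in one bit and all $Y\subseteq\mathcal{Y}$. An algorithm is $(\varepsilon,\delta)$-LEDP if the entire transcript of its interaction with the parties (which parties were queried, the randomizers and privacy parameters assigned, and the randomizers' outputs, over all rounds) is an $(\varepsilon,\delta)$-edge-DP function of $G$. A noninteractive LEDP algorithm has a single round: it is specified by a local randomizer $R_v$ for each node $v$, each node applies $R_v$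 to its adjacency vector once, and a postprocessing algorithm computes the output from the randomizers' outputs. *)

(* Defs.v *)
From HB Require Import structures.
From mathcomp Require Import all_boot all_order all_algebra.
From mathcomp Require Import all_classical all_reals all_analysis.

Set Implicit Arguments.
Unset Strict Implicit.
Unset Printing Implicit Defensive.

Import Order.TTheory GRing.Theory Num.Theory.
Import numFieldNormedType.Exports.

Local Open Scope classical_set_scope.
Local Open Scope ring_scope.

Section Graphs.
Variable n : nat.

Record graph := Graph {
  edges : {set {set 'I_n}};
  edges_card2 : forall e, e \in edges -> #|e| = 2%N }.

(* The diagonal is [false]: [set i; i] is a singleton, hence not an edge. *)
Definition adjacency_matrix (G : graph) : 'M[bool]_n :=
  \matrix_(i, j) ([set i; j]%SET \in edges G).

Definition edge_neighboring (G G' : graph) : Prop :=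
  #|(edges G :\: edges G') :|: (edges G' :\: edges G)| = 1%N.

Definition triangles (G : graph) : nat :=
  #|[set T : {set 'I_n} | (#|T| == 3%N) &&
      [forall i in T, forall j in T,
         (i != j) ==> ([set i; j]%SET \in edges G)]]%SET|.

Definition differ_in_one_bit (a a' : 'rV[bool]_n) : Prop :=
  #|[set j : 'I_n | a ord0 j != a' ord0 j]%SET| = 1%N.

End Graphs.

(* A randomized map is represented by the law of its output on each input. *)
Definition differentially_private (R : realType) (d : measure_display)
    (X : Type) (Y : measurableType d) (neighbor : X -> X -> Prop)
    (eps delta : R) (A : X -> probability Y R) : Prop :=
  forall x x' : X, neighbor x x' ->
  forall S : set Y, measurable S ->
    (A x S <= (expR eps)%:E * A x' S + delta%:E)%E.

Section ProductProbability.
Context (R : realType) (d : measure_display) (Y : measurableType d).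

Section Cons.
Variable n : nat.

Definition cons_tuple_of_pair (p : Y * n.-tuple Y) : n.+1.-tuple Y :=
  [tuple of p.1 :: p.2].

Lemma measurable_cons_tuple_of_pair :
  measurable_fun [set: Y * n.-tuple Y] cons_tuple_of_pair.
Proof. by apply: measurable_cons; [exact: measurable_fst|exact: measurable_snd]. Qed.

HB.instance Definition _ :=
  isMeasurableFun.Build _ _ _ _ cons_tuple_of_pair measurable_cons_tuple_of_pair.

End Cons.

(* The law of a tuple of independent components, the i-th with law [P i]. *)
Fixpoint product_probability (n : nat) :
    ('I_n -> probability Y R) -> probability (n.-tuple Y) R :=
  match n with
  | 0 => fun _ => \d_ [tuple]
  | m.+1 => fun P =>
      distribution (P ord0 \x product_probability (fun i => P (lift ord0 i)))%E
        (@cons_tuple_of_pair m)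
  end.

Lemma product_probability_rectangle (n : nat) (P : 'I_n -> probability Y R)
    (A : 'I_n -> set Y) :
  (forall i, measurable (A i)) ->
  product_probability P [set t | forall i, A i (tnth t i)] =
  (\prod_(i < n) P i (A i))%E.
Proof.
elim: n P A => [|n IH] P A mA.
  rewrite big_ord0 /= diracE mem_set//; by case.
rewrite big_ord_recl /= /distribution /pushforward.
rewrite -IH => [|i]; last exact: mA.
have -> : @cons_tuple_of_pair n @^-1` [set t | forall i, A i (tnth t i)] =
    A ord0 `*` [set t | forall i, A (lift ord0 i) (tnth t i)].
  apply/seteqP; split => -[y t] /=.
    move=> h; split; first by have := h ord0; rewrite tnth0.
    by move=> i; have := h (lift ord0 i); rewrite tnthS.
  move=> [h0 h] i; case: (unliftP ord0 i) => [j ->|->].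
    by rewrite tnthS; exact: h.
  by rewrite tnth0.
rewrite product_measure1E//.
have -> : [set t : n.-tuple Y | forall i, A (lift ord0 i) (tnth t i)] =
    \bigcap_(i in [set: 'I_n]) ((@tnth _ Y ^~ i) @^-1` A (lift ord0 i)).
  by apply/seteqP; split => t /= h i => [_|]; exact: h.
apply: fin_bigcap_measurable => // i _.
by rewrite -[X in measurable X]setTI; exact: measurable_tnth.
Qed.

End ProductProbability.

Section NoninteractiveLEDP.
Context (R : realType) (d : measure_display) (Y : measurableType d) (n : nat).

(* Each randomizer carries its own privacy parameters, which need not be those
   of the whole algorithm. *)
Record local_randomizer := LocalRandomizer {
  lr_eps : R;
  lr_delta : R;
  lr_eps_ge0 : 0 <= lr_eps;
  lr_delta_ge0 : 0 <= lr_delta;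
  lr_map :> 'rV[bool]_n -> probability Y R;
  lr_private :
    differentially_private (@differ_in_one_bit n) lr_eps lr_delta lr_map }.

(* The postprocessing may be randomized: it is a Markov kernel. *)
Record noninteractive_algorithm := NoninteractiveAlgorithm {
  randomizers : 'I_n -> local_randomizer;
  postprocessing : R.-pker (n.-tuple Y) ~> (measurableTypeR R) }.

(* In the noninteractive setting the nodes queried, the randomizers and their
   privacy parameters do not depend on the graph, so the only varying part of
   the transcript is the tuple of outputs of the randomizers. *)
Definition transcript (A : noninteractive_algorithm) (G : graph n) :
    probability (n.-tuple Y) R :=
  product_probability (fun v => randomizers A v (row v (adjacency_matrix G))).

Definition ledp (eps delta : R) (A : noninteractive_algorithm) : Prop :=
  differentially_private (@edge_neighboring n) eps delta (transcript A).

Definition output_probability (A : noninteractive_algorithm) (G : graph n)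
    (S : set R) : \bar R :=
  (\int[transcript A G]_t postprocessing A t S)%E.

Definition approximates_triangles (A : noninteractive_algorithm) (G : graph n)
    (alpha p : R) : Prop :=
  (p%:E <= output_probability A G
             [set z : R | (`|z - (triangles G)%:R| <= alpha)%R])%E.

End NoninteractiveLEDP.

(* Main.v *)
(* A set of m^2 bits X, placed as a bipartite graph between parts U and V of size
   m = n / 3, is a database; joining a third part W completely to chosen subsets
   a of U and b of V gives a graph with exactly m * (a^T X b) triangles. A vertex
   of U or V has only two possible rows, according to its membership in a or b,
   and the rows of W do not depend on X. Hence the transcripts for (a, b) empty
   and (a, b) full, drawn once and independently, are enough to answer all the
   queries (a, b), and they form a (2 eps, (1 + e^eps) delta)-private function of
   X. If alpha = o(n^2), these answers have error o(m). For a 0/1 matrix with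
   many disagreements with X, |a^T (X - Z) b| is of order m on a constant fraction
   of the queries, so the answers determine most bits of X, contradicting
   privacy. *)
Require Import Defs.
From HB Require Import structures.
From mathcomp Require Import all_boot all_order all_algebra.
From mathcomp Require Import all_classical all_reals all_analysis.
From mathcomp Require Import measurable_realfun.
From mathcomp Require Import ring lra zify.

Set Implicit Arguments.
Unset Strict Implicit.
Unset Printing Implicit Defensive.

Import Order.TTheory GRing.Theory Num.Theory.
Import numFieldNormedType.Exports.

Local Open Scope classical_set_scope.
Local Open Scope ring_scope.

(** * Flips and complements on the Boolean cube *)

Section Cube.
Context {I : finType}.
Implicit Types (i : I) (a : {ffun I -> bool}).

Definition flip i a := [ffun j => if j == i then ~~ a j else a j].

Lemma flipK i : involutive (flip i).
Proof.
by move=> a; apply/ffunP => j; rewrite !ffunE; case: eqP => // _; rewrite negbK.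
Qed.

Lemma sum_flip (V : nmodType) i (F : {ffun I -> bool} -> V) :
  \sum_a F (flip i a) = \sum_a F a.
Proof. by rewrite [RHS](reindex_inj (inv_inj (flipK i))). Qed.

Definition negate a := [ffun j => ~~ a j].

Lemma negateK : involutive negate.
Proof. by move=> a; apply/ffunP => j; rewrite !ffunE negbK. Qed.

Lemma sum_negate (V : nmodType) (F : {ffun I -> bool} -> V) :
  \sum_a F (negate a) = \sum_a F a.
Proof. by rewrite [RHS](reindex_inj (inv_inj negateK)). Qed.

End Cube.

(** * Anticoncentration of random linear and bilinear forms *)

Section Anticoncentration.
Context {R : realFieldType}.

Section Linear.
Context {I : finType}.
Implicit Types (x : I -> R) (a : {ffun I -> bool}).
Local Notation C := (#|{ffun I -> bool}|%:R : R).

(** The sum runs over a list, so that moments can be computed by induction while the signs stay on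
    the whole cube. *)
Definition rademacher x (r : seq I) a : R := \sum_(i <- r) (-1) ^+ (a i) * x i.

Lemma rademacher_flip x r i a :
  i \notin r -> rademacher x r (flip i a) = rademacher x r a.
Proof.
move=> ir; apply: eq_big_seq => j jr; rewrite ffunE.
by case: eqP ir => // <-; rewrite jr.
Qed.

Lemma rademacher_cons_flip x r i a : i \notin r ->
  rademacher x (i :: r) (flip i a) = - ((-1) ^+ (a i) * x i) + rademacher x r a.
Proof.
move=> ir; rewrite /rademacher big_cons; congr (_ + _).
  by rewrite ffunE eqxx; case: (a i); rewrite /= ?expr0 ?expr1; ring.
exact: rademacher_flip.
Qed.

Lemma sum_cube_const (k : R) : \sum_(a : {ffun I -> bool}) k = C * k.
Proof. by rewrite sumr_const mulr_natl. Qed.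

(** Induction on [r]: pairing [a] with [flip i a] averages over the sign of [x i] and cancels its
    odd powers. *)
Lemma rademacher_moments x r : uniq r ->
  \sum_a rademacher x r a ^+ 2 = C * \sum_(i <- r) x i ^+ 2 /\
  \sum_a rademacher x r a ^+ 4 <= 3 * C * (\sum_(i <- r) x i ^+ 2) ^+ 2.
Proof.
elim: r => [|i r IH] /=.
  move=> _; split.
    by rewrite big_nil mulr0 big1 // => a _; rewrite /rademacher big_nil expr0n.
  rewrite big_nil expr0n mulr0 big1 // => a _.
  by rewrite /rademacher big_nil expr0n.
case/andP => ir /IH [{IH} H2 H4].
have E2 (a : {ffun I -> bool}) :
    rademacher x (i :: r) a ^+ 2 + rademacher x (i :: r) (flip i a) ^+ 2 =
    2 * x i ^+ 2 + 2 * rademacher x r a ^+ 2.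
  rewrite rademacher_cons_flip// {1}/rademacher big_cons -/(rademacher x r a).
  by case: (a i); rewrite /= ?expr0 ?expr1; ring.
have E4 (a : {ffun I -> bool}) :
    rademacher x (i :: r) a ^+ 4 + rademacher x (i :: r) (flip i a) ^+ 4 =
    2 * x i ^+ 4 + 12 * x i ^+ 2 * rademacher x r a ^+ 2
    + 2 * rademacher x r a ^+ 4.
  rewrite rademacher_cons_flip// {1}/rademacher big_cons -/(rademacher x r a).
  by case: (a i); rewrite /= ?expr0 ?expr1; ring.
have half k : 2 * \sum_a rademacher x (i :: r) a ^+ k =
    \sum_a (rademacher x (i :: r) a ^+ k + rademacher x (i :: r) (flip i a) ^+ k).
  rewrite big_split /= (sum_flip i (fun a => rademacher x (i :: r) a ^+ k)).
  by ring.
rewrite big_cons; set V := \sum_(j <- r) _ in H2 H4 *.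
split.
  apply: (@mulfI _ 2); rewrite ?pnatr_eq0// half (eq_bigr _ (fun a _ => E2 a)).
  by rewrite big_split /= -!mulr_sumr H2 sum_cube_const; ring.
rewrite -(@ler_pM2l _ 2)// half (eq_bigr _ (fun a _ => E4 a)).
rewrite !big_split /= -!mulr_sumr H2 sum_cube_const.
have C0 : 0 <= C by rewrite ler0n.
have X0 : 0 <= C * x i ^+ 4 by rewrite mulr_ge0// exprn_even_ge0.
by move: H4 X0; set c := C; nra.
Qed.

(* Paley-Zygmund from the second and fourth moments, through the pointwise
   bound [z^2 <= z^4 / (4t) + t] with [t = 3 V]. *)
Lemma rademacher_anticoncentration x :
  C <= 12 *
  \sum_(a : {ffun I -> bool})
    (\sum_i x i ^+ 2 <= 2 * rademacher x (index_enum I) a ^+ 2)%R%:R.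
Proof.
have [H2 H4] := rademacher_moments x (index_enum_uniq I).
set V := \sum_i x i ^+ 2 in H2 H4 *.
have V0 : 0 <= V by apply: sumr_ge0 => i _; rewrite sqr_ge0.
have C0 : 0 <= C by rewrite ler0n.
case: (ltgtP V 0) V0 => // [Vp|V0] _; last first.
  rewrite -[leLHS]mulr1 -sum_cube_const mulr_sumr; apply: ler_sum => a _.
  by rewrite V0 (_ : 0 <= _) ?mulr1 ?ler1n// mulr_ge0// sqr_ge0.
have pt z :
    z ^+ 2 * (12 * V) <=
    6 * V ^+ 2 + z ^+ 4 + 36 * V ^+ 2 * (V <= 2 * z ^+ 2)%R%:R.
  have z4 : 0 <= z ^+ 4 by rewrite exprn_even_ge0.
  case: (leP V (2 * z ^+ 2)) => hz; rewrite /= ?mulr1 ?mulr0 ?addr0.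
    by have := sqr_ge0 (z ^+ 2 - 6 * V); nra.
  have : 0 <= (V - 2 * z ^+ 2) * V by rewrite mulr_ge0 ?subr_ge0// ltW.
  by nra.
have : \sum_a (rademacher x (index_enum I) a ^+ 2 * (12 * V)) <= \sum_a
   (6 * V ^+ 2 + rademacher x (index_enum I) a ^+ 4
   + 36 * V ^+ 2 * (V <= 2 * rademacher x (index_enum I) a ^+ 2)%R%:R).
  by apply: ler_sum => a _; exact: pt.
(* The moments give [12 V^2 C <= 6 V^2 C + 3 V^2 C + 36 V^2 N], hence [C <= 12 N]. *)
rewrite -mulr_suml H2 !big_split /= !sum_cube_const -mulr_sumr.
set N := \sum_a (_ <= _)%R%:R; set S4 := \sum_a _ ^+ 4 in H4 *.
set c := C in C0 H4 * => h.
have : V ^+ 2 * (3 * c) <= V ^+ 2 * (36 * N) by clearbody c N S4 V; nra.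
by rewrite ler_pM2l ?exprn_gt0//; lra.
Qed.

(** The subset sums of [a] and of its complement differ by a Rademacher sum. When the latter is
    large, one of the two is large, which costs a factor 2 in frequency. *)
Lemma subset_sum_anticoncentration x :
  C <= 24 *
  \sum_(a : {ffun I -> bool})
    (\sum_i x i ^+ 2 <= 8 * (\sum_i (a i)%:R * x i) ^+ 2)%R%:R.
Proof.
have := rademacher_anticoncentration x.
set V := \sum_i x i ^+ 2; set N := \sum_a _ => hN.
have E (a : {ffun I -> bool}) :
    2 * \sum_i (a i)%:R * x i = \sum_i x i - rademacher x (index_enum I) a.
  rewrite mulr_sumr /rademacher -sumrB; apply: eq_bigr => i _.
  by case: (a i); rewrite /= ?expr0 ?expr1; ring.
have En (a : {ffun I -> bool}) :
    2 * \sum_i (negate a i)%:R * x i = \sum_i x i + rademacher x (index_enum I) a.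
  rewrite mulr_sumr /rademacher -big_split /=; apply: eq_bigr => i _.
  by rewrite ffunE; case: (a i); rewrite /= ?expr0 ?expr1; ring.
have le : N <= \sum_(a : {ffun I -> bool})
   ((V <= 8 * (\sum_i (a i)%:R * x i) ^+ 2)%R%:R +
    (V <= 8 * (\sum_i (negate a i)%:R * x i) ^+ 2)%R%:R).
  apply: ler_sum => a _; move: (E a) (En a).
  set z := rademacher _ _ _; set s := \sum_i x i.
  set p := \sum_i _; set q := \sum_i _ => Ep Eq.
  have [hz|hz] := leP V (2 * z ^+ 2); last by rewrite addr_ge0.
  have [hp|hp] := leP V (8 * p ^+ 2); first by rewrite lerDl.
  have [hq|hq] := leP V (8 * q ^+ 2); first by rewrite lerDr.
  suff : V < V by rewrite ltxx.
  have zE : z = q - p by lra.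
  have sE : s = p + q by lra.
  by have := sqr_ge0 (p + q); move: hz hp hq; rewrite zE; clearbody p q V; nra.
move: le; rewrite big_split /=.
rewrite (sum_negate (fun a : {ffun I -> bool} =>
  (V <= 8 * (\sum_i (a i)%:R * x i) ^+ 2)%R%:R)).
by clearbody N => h; lra.
Qed.

End Linear.

(** The subset-sum bound is applied to each row with random [b], then to the vector of row sums with
    random [a]. The constants are [3072 = 8 * 384] and [1152 = 24 * 48]. *)
Lemma bilinear_anticoncentration (I J : finType) (M : I -> J -> R) :
  #|{ffun I -> bool}|%:R * #|{ffun J -> bool}|%:R <=
  1152 * \sum_(b : {ffun J -> bool}) \sum_(a : {ffun I -> bool})
    (\sum_i \sum_j M i j ^+ 2 <=
     3072 * (\sum_i (a i)%:R * \sum_j (b j)%:R * M i j) ^+ 2)%R%:R :> R.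
Proof.
set cI : R := #|{ffun I -> bool}|%:R; set cJ : R := #|{ffun J -> bool}|%:R.
pose m i := \sum_j M i j ^+ 2.
pose v (b : {ffun J -> bool}) i := \sum_j (b j)%:R * M i j.
rewrite -/(\sum_i m i); set V := \sum_i m i.
have m0 i : 0 <= m i by apply: sumr_ge0 => j _; rewrite sqr_ge0.
have V0 : 0 <= V by apply: sumr_ge0.
have cI0 : 0 <= cI by rewrite ler0n.
case: (ltgtP V 0) V0 => // [Vp|V0] _; last first.
  rewrite (eq_bigr (fun=> cI)) => [|b _].
    by rewrite sum_cube_const -/cJ mulrC ler_peMl ?mulr_ge0// ler1n.
  rewrite -[RHS]mulr1 -sum_cube_const; apply: eq_bigr => a _.
  suff -> : V <= 3072 * (\sum_i (a i)%:R * v b i) ^+ 2 by [].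
  by rewrite V0 mulr_ge0 ?sqr_ge0 ?ler0n.
(* Since [384 = 8 * 48], for a [b] that is not heavy the rows with [m i <= 8 * v b i ^+ 2] carry
   mass at most [V / 48]. The rowwise bound makes this mass at least [V / 24] on average, so at
   least one [b] in 48 is heavy. *)
pose heavy b := V <= 384 * \sum_i v b i ^+ 2.
have heavy_often : cJ <= 48 * \sum_b (heavy b)%:R.
  have pt b : \sum_i m i * (m i <= 8 * v b i ^+ 2)%R%:R <=
      V / 48 + V * (heavy b)%:R.
    rewrite /heavy; case: (leP V (384 * _)) => hb; rewrite ?mulr1 ?mulr0 ?addr0 /=.
      apply: (@le_trans _ _ V); last by rewrite lerDr divr_ge0// ltW.
      by apply: ler_sum => i _; case: (leP (m i) (8 * _)); rewrite ?mulr1 ?mulr0.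
    apply: (@le_trans _ _ (\sum_i 8 * v b i ^+ 2)).
      apply: ler_sum => i _; case: (leP (m i) (8 * _)); rewrite ?mulr1 ?mulr0// => _.
      by rewrite mulr_ge0 ?sqr_ge0 ?ler0n.
    by rewrite -mulr_sumr; lra.
  have : \sum_b \sum_i m i * (m i <= 8 * v b i ^+ 2)%R%:R <=
      \sum_b (V / 48 + V * (heavy b)%:R) by apply: ler_sum => b _; exact: pt.
  rewrite exchange_big big_split /= sum_cube_const -/cJ -mulr_sumr.
  have : \sum_i m i * cJ <=
      \sum_i 24 * \sum_b m i * (m i <= 8 * v b i ^+ 2)%R%:R.
    apply: ler_sum => i _; rewrite -mulr_sumr mulrCA ler_wpM2l//.
    exact: subset_sum_anticoncentration.
  rewrite -mulr_suml -mulr_sumr -/V; set S := \sum_i _; set N := \sum_b _.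
  move=> h1 h2; have : V * cJ <= V * (48 * N) by clearbody cJ V S N; nra.
  by rewrite ler_pM2l.
have heavy_rows b : cI * (heavy b)%:R <= 24 * \sum_(a : {ffun I -> bool})
    (V <= 3072 * (\sum_i (a i)%:R * v b i) ^+ 2)%R%:R.
  rewrite /heavy; case: (leP V (384 * _)) => hb; rewrite ?mulr1 ?mulr0; last first.
    by rewrite mulr_ge0// sumr_ge0.
  apply: le_trans (subset_sum_anticoncentration (v b)) _.
  rewrite ler_wpM2l//; apply: ler_sum => a _.
  case: (leP _ (8 * _)) => [h|_]; last by rewrite ler0n.
  suff -> : V <= 3072 * (\sum_i (a i)%:R * v b i) ^+ 2 by [].
  by apply: le_trans hb _; lra.
have : \sum_b cI * (heavy b)%:R <= \sum_b 24 * \sum_(a : {ffun I -> bool})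
    (V <= 3072 * (\sum_i (a i)%:R * v b i) ^+ 2)%R%:R.
  by apply: ler_sum => b _; exact: heavy_rows.
rewrite -!mulr_sumr; set N := \sum_b _ in heavy_often *.
set T := \sum_b _ => h.
have := ler_wpM2l cI0 heavy_often; clearbody cI cJ T N; lra.
Qed.

End Anticoncentration.

(** * Privacy limits bitwise reconstruction *)

(* Flipping bit [k] of the database turns the event that the output is right at
   [k] into its complement, so for a uniform database privacy bounds the
   probability of being right at [k] by [(s + dlt) / (1 + s)]. *)
Lemma private_reconstruction_bound (R : realFieldType) (K : finType)
    (pi : {ffun K -> bool} -> {ffun K -> bool} -> R) (s dlt r g : R) :
  (0 < #|K|)%N -> 0 <= s -> 0 <= r ->
  (forall X Z, 0 <= pi X Z) -> (forall X, \sum_Z pi X Z = 1) ->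
  (forall X k (S : pred {ffun K -> bool}),
    \sum_(Z | S Z) pi X Z <= s * \sum_(Z | S Z) pi (flip k X) Z + dlt) ->
  (forall X : {ffun K -> bool},
    r <= \sum_(Z : {ffun K -> bool} |
      (g * #|K|%:R <= #|[pred k | X k == Z k]|%:R)%R) pi X Z) ->
  0 <= g ->
  (1 + s) * (r * g) <= s + dlt.
Proof.
move=> K0 s0 r0 pi0 pi1 dp good g0.
pose C : R := #|{ffun K -> bool}|%:R.
have C0 : 0 < C by rewrite ltr0n; apply/card_gt0P; exists [ffun=> false].
pose rho (X : {ffun K -> bool}) k :=
  \sum_(Z : {ffun K -> bool} | X k == Z k) pi X Z.
have le_rho X k : rho X k <= s * (1 - rho (flip k X) k) + dlt.
  apply: le_trans (dp X k (fun Z => X k == Z k)) _.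
  rewrite lerD2r ler_wpM2l// -(pi1 (flip k X)).
  rewrite [in leRHS](bigID (fun Z : {ffun K -> bool} => flip k X k == Z k)) /=.
  rewrite /rho addrAC subrr add0r le_eqVlt; apply/orP; left; apply/eqP.
  by apply: eq_bigl => Z; rewrite ffunE eqxx; case: (X k) (Z k) => [] [].
(* Over all [X], [rho X k] and [rho (flip k X) k] have the same sum, so [le_rho] becomes a linear
   inequality in that sum. *)
have sum_rho k : (1 + s) * \sum_X rho X k <= (s + dlt) * C.
  have : \sum_X rho X k <= \sum_X (s * (1 - rho (flip k X) k) + dlt).
    by apply: ler_sum => X _; exact: le_rho.
  rewrite big_split /= -mulr_sumr sumrB !sum_cube_const.
  by rewrite (sum_flip k (rho^~ k)) -/C; set S := \sum_X _; lra.
(* After exchanging sums, the right side is the expected number of positions where the output agrees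
   with [X]. *)
have rho_ge X : r * (g * #|K|%:R) <= \sum_k rho X k.
  rewrite /rho (exchange_big_dep xpredT)//=.
  apply: (@le_trans _ _
    (\sum_(Z : {ffun K -> bool} |
       (g * #|K|%:R <= #|[pred k | X k == Z k]|%:R)%R)
       pi X Z * (g * #|K|%:R))).
    by rewrite -mulr_suml ler_wpM2r ?good// mulr_ge0.
  rewrite [leRHS](bigID (fun Z : {ffun K -> bool} =>
    g * #|K|%:R <= #|[pred k | X k == Z k]|%:R)) /=.
  rewrite ler_wpDr//; first by rewrite sumr_ge0// => Z _; rewrite sumr_ge0.
  apply: ler_sum => Z hZ; rewrite sumr_const -[leRHS]mulr_natr ler_wpM2l//.
have : (1 + s) * \sum_(X : {ffun K -> bool}) r * (g * #|K|%:R) <=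
    (s + dlt) * C * #|K|%:R.
  apply: (@le_trans _ _ ((1 + s) * \sum_X \sum_k rho X k)).
    by rewrite ler_wpM2l ?addr_ge0// ler_sum.
  rewrite exchange_big /= mulr_sumr mulr_natr -sumr_const.
  by apply: ler_sum => k _; exact: sum_rho.
have K0' : 0 < #|K|%:R :> R by rewrite ltr0n.
rewrite sum_cube_const -/C => h; rewrite -(ler_pM2r (mulr_gt0 C0 K0')).
by clearbody C; lra.
Qed.

(** * Graphs encoding a database and a query *)

Lemma set2_eq (T : finType) (i j k l : T) : [set i; j]%SET = [set k; l]%SET ->
  (i = k /\ j = l) \/ (i = l /\ j = k).
Proof.
move=> E.
have := set21 i j; have := set22 i j; have := set21 k l; have := set22 k l.
rewrite -{1 2}E {3 4}E !inE.
by do 4 (case/orP => /eqP ?); subst; auto.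
Qed.

Section QueryGraph.
Variables (n m : nat) (emb : 'I_m + 'I_m + 'I_m -> 'I_n).
Hypothesis emb_inj : injective emb.
Local Notation bits := {ffun 'I_m * 'I_m -> bool}.
Local Notation query := {ffun 'I_m -> bool}.

(** Partial inverse of [emb]; vertices with role [None] lie outside the three parts and stay
    isolated. *)
Definition role (i : 'I_n) : option ('I_m + 'I_m + 'I_m) :=
  [pick x | emb x == i].

Lemma role_emb x : role (emb x) = Some x.
Proof.
rewrite /role; case: pickP => [y /eqP/emb_inj -> //|/(_ x)].
by rewrite eqxx.
Qed.

Lemma role_some i x : role i = Some x -> i = emb x.
Proof. by rewrite /role; case: pickP => // y /eqP <- [->]. Qed.

Definition role_adjacent (X : bits) (a b : query) (x y : 'I_m + 'I_m + 'I_m) :=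
  match x, y with
  | inl (inl u), inl (inr v) | inl (inr v), inl (inl u) => X (u, v)
  | inl (inl u), inr _ | inr _, inl (inl u) => a u
  | inl (inr v), inr _ | inr _, inl (inr v) => b v
  | _, _ => false
  end.

Lemma role_adjacentC X a b x y :
  role_adjacent X a b x y = role_adjacent X a b y x.
Proof. by move: x y => [[u|v]|w] [[u'|v']|w']. Qed.

Definition adjacent X a b (i j : 'I_n) :=
  match role i, role j with
  | Some x, Some y => role_adjacent X a b x y
  | _, _ => false
  end.

Lemma adjacentC X a b i j : adjacent X a b i j = adjacent X a b j i.
Proof.
rewrite /adjacent; case: (role i) (role j) => [x|] [y|] //.
exact: role_adjacentC.
Qed.

Lemma adjacentxx X a b i : adjacent X a b i i = false.
Proof. by rewrite /adjacent; case: (role i) => [[[]|]|]. Qed.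

Lemma adjacent_emb X a b x y :
  adjacent X a b (emb x) (emb y) = role_adjacent X a b x y.
Proof. by rewrite /adjacent !role_emb. Qed.

Lemma adjacentP X a b i j : adjacent X a b i j ->
  exists x y, [/\ i = emb x, j = emb y & role_adjacent X a b x y].
Proof.
rewrite /adjacent; case Ei: (role i) => [x|] //; case Ej: (role j) => [y|] // h.
by exists x, y; rewrite (role_some Ei) (role_some Ej).
Qed.

Definition query_edges X a b : {set {set 'I_n}} :=
  [set S | [exists i, exists j, adjacent X a b i j && (S == [set i; j])]]%SET.

Lemma query_edges_set2 X a b i j :
  ([set i; j]%SET \in query_edges X a b) = adjacent X a b i j.
Proof.
rewrite inE; apply/existsP/idP => [[k /existsP[l /andP[h /eqP E]]]|h].
  by case: (set2_eq E) => -[-> ->] //; rewrite adjacentC.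
by exists i; apply/existsP; exists j; rewrite h eqxx.
Qed.

Lemma query_edges_card2 X a b e : e \in query_edges X a b -> #|e| = 2%N.
Proof.
rewrite inE => /existsP[i /existsP[j /andP[h /eqP ->]]].
by rewrite cards2; case: eqP h => [->|//]; rewrite adjacentxx.
Qed.

(* The database [X] sits between two parts of size [m]; the third part is joined
   in full to the vertices selected by the query [(a, b)]. *)
Definition query_graph X a b : graph n :=
  Graph (@query_edges_card2 X a b).

Lemma adjacency_query_graph X a b i j :
  adjacency_matrix (query_graph X a b) i j = adjacent X a b i j.
Proof. by rewrite mxE query_edges_set2. Qed.

(** There are no edges inside a part, so a triangle has one vertex in each part. All vertices of the
    third part have the same neighbours, whence the factor [m]. *)
Lemma triangles_query_graph X a b :
  triangles (query_graph X a b) =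
  (m * \sum_u \sum_v a u * (b v * X (u, v)))%N.
Proof.
pose tri (t : 'I_m * 'I_m * 'I_m) : {set 'I_n} :=
  [set emb (inl (inl t.1.1)); emb (inl (inr t.1.2)); emb (inr t.2)]%SET.
pose D := [set t : 'I_m * 'I_m * 'I_m | [&& a t.1.1, b t.1.2 & X t.1]]%SET.
have -> : triangles (query_graph X a b) = #|tri @: D|.
  apply: eq_card => T; rewrite inE; apply/andP/imsetP.
    case=> /eqP T3 /forall_inP adjT.
    have [i [j [k [ET ij ik jk]]]] : exists i j k,
        [/\ T = [set i; j; k]%SET, i != j, i != k & j != k].
      have /card_gt0P[i iT] : (0 < #|T|)%N by rewrite T3.
      have /eqP/cards2P[j [k [jk Tjk]]] : #|T :\ i|%SET = 2%N.
        by move: T3; rewrite (cardsD1 i) iT add1n => -[].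
      have := set21 j k; have := set22 j k.
      rewrite -Tjk !inE => /andP[ki _] /andP[ji _].
      exists i, j, k; split => //; rewrite 1?eq_sym//.
      by rewrite -finset.setUA -Tjk finset.setD1K.
    have adj p q : p \in [set i; j; k]%SET -> q \in [set i; j; k]%SET ->
        p != q -> adjacent X a b p q.
      move=> pT qT pq; rewrite -query_edges_set2.
      rewrite -ET in pT qT; have /forall_inP/(_ q qT)/implyP := adjT p pT.
      exact.
    have := adj i j; have := adj i k; have := adj j k.
    rewrite !inE !eqxx ?orbT ij ik jk /= => /(_ isT isT isT) Ajk.
    move=> /(_ isT isT isT) Aik /(_ isT isT isT) Aij.
    have [x [y [Ei Ej _]]] := adjacentP Aij.
    have [_ [z [_ Ek _]]] := adjacentP Aik.
    rewrite ET; move: Aij Aik Ajk; rewrite {}Ei {}Ej {}Ek !adjacent_emb.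
    have set3 (p q r : 'I_n) : [set p; q; r]%SET = [set q; p; r]%SET /\
        [set p; q; r]%SET = [set p; r; q]%SET.
      split; apply/finset.setP => t; rewrite !inE; first by rewrite (orbC (t == p)).
      by rewrite orbAC.
    (* Only the six orderings of one vertex per part survive; [set3] permutes each into the order
       used by [tri]. *)
    case: x y z => [[u|v]|w] [[u'|v']|w'] [[u''|v'']|w''] //= h1 h2 h3.
    - by exists (u, v', w''); rewrite // inE /= h1 h2 h3.
    - by exists (u, v'', w'); rewrite ?inE /= ?h1 ?h2 ?h3// (set3 _ _ _).2.
    - by exists (u', v, w''); rewrite ?inE /= ?h1 ?h2 ?h3// (set3 _ _ _).1.
    - exists (u'', v, w'); rewrite ?inE /= ?h1 ?h2 ?h3//.
      by rewrite (set3 _ _ _).2 (set3 _ _ _).1.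
    - exists (u', v'', w); rewrite ?inE /= ?h1 ?h2 ?h3//.
      by rewrite (set3 _ _ _).1 (set3 _ _ _).2.
    - exists (u'', v', w); rewrite ?inE /= ?h1 ?h2 ?h3//.
      by rewrite (set3 _ _ _).1 (set3 _ _ _).2 (set3 _ _ _).1.
  case=> -[[u v] w]; rewrite inE => /and3P[/= au bv Xuv] ->; split.
    by rewrite /tri finset.setUC cardsU1 cards2 !inE !(inj_eq emb_inj).
  apply/forall_inP => i iT; apply/forall_inP => j jT; apply/implyP.
  move: iT jT; rewrite query_edges_set2 /tri /= !inE.
  by do 2![case/orP => [/orP[]|] /eqP ->]; rewrite ?eqxx// adjacent_emb.
rewrite card_imset; last first.
  move=> [[u v] w] [[u' v'] w'] E.
  have mem x : (emb x \in tri (u, v, w)) = (emb x \in tri (u', v', w')).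
    by rewrite E.
  have := mem (inl (inl u)); have := mem (inl (inr v)); have := mem (inr w).
  rewrite !inE !(inj_eq emb_inj) !eqxx /= ?orbT ?orbF.
  by move=> /esym/eqP[->] /esym/eqP[->] /esym/eqP[->].
rewrite -sum1_card big_mkcond /=.
transitivity (\sum_p \sum_(w < m) a p.1 * (b p.2 * X p))%N.
  rewrite pair_bigA; apply: eq_bigr => -[[u v] w] _.
  by rewrite inE /=; case: (a u) (b v) (X (u, v)) => [] [] [].
rewrite exchange_big sum_nat_const card_ord; congr (_ * _)%N.
by rewrite (pair_bigA _ (fun u v => a u * (b v * X (u, v)))%N); apply: eq_bigr => -[].
Qed.

(** Tells whether the full or the empty query reproduces the row of [i]. The default [false] is
    harmless: the third part is treated separately, and vertices without a role have an empty row in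
    both graphs. *)
Definition copy_choice (a b : query) (i : 'I_n) : bool :=
  match role i with
  | Some (inl (inl u)) => a u
  | Some (inl (inr v)) => b v
  | _ => false
  end.

Definition in_third_part (i : 'I_n) : bool :=
  if role i is Some (inr _) then true else false.

(** A vertex of the first two parts sees the query only through its own membership bit, and a vertex
    of the third part sees no bit of [X]. *)
Lemma row_query_graph X a b i :
  row i (adjacency_matrix (query_graph X a b)) =
  row i (adjacency_matrix
    (if in_third_part i then query_graph [ffun=> false] a b
     else if copy_choice a b i then query_graph X [ffun=> true] [ffun=> true]
     else query_graph X [ffun=> false] [ffun=> false])).
Proof.
apply/rowP => j; rewrite [LHS]mxE [RHS]mxE.
rewrite /in_third_part /copy_choice adjacency_query_graph.
case Ei: (role i) => [[[u|v]|w]|]; rewrite /=;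
  rewrite ?(fun_if (fun G => adjacency_matrix G i j)) !adjacency_query_graph;
  rewrite /adjacent Ei //=; case: (role j) => [[[u'|v']|w']|] //=;
  rewrite ?ffunE ?if_same //; by case: ifP.
Qed.

Lemma query_graph_neighbor X k a b :
  edge_neighboring (query_graph X a b) (query_graph (flip k X) a b).
Proof.
case: k => u v.
have E : ((query_edges X a b :\: query_edges (flip (u, v) X) a b) :|:
    (query_edges (flip (u, v) X) a b :\: query_edges X a b) =
    [set [set emb (inl (inl u)); emb (inl (inr v))]])%SET.
  apply/finset.setP => S; rewrite finset.in_set1 finset.in_setU !finset.in_setD.
  have [->|Se] := eqVneq S.
    rewrite !query_edges_set2 !adjacent_emb /= ffunE eqxx.
    by case: (X (u, v)).
  suff -> : (S \in query_edges X a b) = (S \in query_edges (flip (u, v) X) a b).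
    by rewrite andNb.
  rewrite !inE; apply: eq_existsb => i; apply: eq_existsb => j.
  case: eqP => [SE|_]; rewrite ?andbF// !andbT /adjacent.
  case Ei: (role i) => [x|] //; case Ej: (role j) => [y|] //.
  move: (role_some Ei) (role_some Ej) SE => -> -> SE.
  case: x y SE {Ei Ej} => [[u'|v']|w'] [[u''|v'']|w''] //= SE; rewrite ffunE;
    by case: eqP => // -[? ?]; subst; rewrite ?eqxx // finset.setUC eqxx in Se.
by rewrite /edge_neighboring /= E cards1.
Qed.

End QueryGraph.

Lemma exists_role_embedding n m : (3 * m <= n)%N ->
  exists emb : 'I_m + 'I_m + 'I_m -> 'I_n, injective emb.
Proof.
move=> le_mn.
have le : (#|{: 'I_m + 'I_m + 'I_m}| <= n)%N.
  by rewrite !card_sum !card_ord; lia.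
exists (fun x => widen_ord le (enum_rank x)) => x y /(congr1 val) /= h.
by apply: enum_rank_inj; exact: val_inj.
Qed.

(** * Mixing independent product tuples coordinatewise *)

Section Mixing.
Context (R : realType) (d : measure_display) (Y : measurableType d) (n : nat).
Local Open Scope ereal_scope.
Implicit Types (P Q : 'I_n -> probability Y R) (c : 'I_n -> bool).

Definition rectangle (A : 'I_n -> set Y) : set (n.-tuple Y) :=
  [set t | forall i, A i (tnth t i)].

Lemma measurable_rectangle (A : 'I_n -> set Y) :
  (forall i, measurable (A i)) -> measurable (rectangle A).
Proof.
move=> mA; have -> : rectangle A =
    \bigcap_(i in [set: 'I_n]) ((@tnth _ Y ^~ i) @^-1` A i).
  by apply/seteqP; split => t /= h i => [_|]; exact: h.
apply: fin_bigcap_measurable => // i _.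
by rewrite -[X in measurable X]setTI; exact: measurable_tnth.
Qed.

Definition rectangles : set (set (n.-tuple Y)) :=
  [set S | exists2 A : 'I_n -> set Y,
    (forall i, measurable (A i)) & S = rectangle A].

(** The generating one-coordinate cylinders are rectangles with [setT] in all other coordinates.
    Rectangles thus form a generating pi-system on which laws can be compared. *)
Lemma measurable_tuple_rectangles :
  (measurable : set (set (n.-tuple Y))) = <<s rectangles >>.
Proof.
apply/seteqP; split; last first.
  apply: smallest_sub; first exact: sigma_algebra_measurable.
  by move=> _ [A mA ->]; exact: measurable_rectangle.
apply: smallest_sub; first exact: smallest_sigma_algebra.
move=> S; rewrite -bigcup_seq /= => -[i _ [A mA <-]].
apply: sub_sigma_algebra; rewrite setTI.
exists (fun j => if j == i then A else setT) => [j|]; first by case: ifP.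
apply/seteqP; split => [t /= At j|t /= /(_ i)]; last by rewrite eqxx.
by case: eqP => // ->.
Qed.

Lemma rectangle_setT : rectangle (fun=> setT) = setT.
Proof. by apply/seteqP; split. Qed.

Lemma rectangles_setI : setI_closed rectangles.
Proof.
move=> _ _ [A mA ->] [B mB ->]; exists (fun i => A i `&` B i).
  by move=> i; exact: measurableI.
apply/seteqP; split => t; first by move=> [hA hB] i; split.
by move=> h; split => i; have [] := h i.
Qed.

Definition mix c (p : n.-tuple Y * n.-tuple Y) : n.-tuple Y :=
  [tuple if c i then tnth p.1 i else tnth p.2 i | i < n].

Lemma measurable_mix c : measurable_fun setT (mix c).
Proof.
apply/measurable_fun_tnthP => i.
rewrite (_ : _ \o _ =
    fun p => if c i then tnth p.1 i else tnth p.2 i); last first.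
  by apply/funext => p /=; rewrite tnth_mktuple.
by case: (c i); apply: (measurableT_comp (measurable_tnth i)).
Qed.

HB.instance Definition _ c :=
  isMeasurableFun.Build _ _ _ _ (mix c) (measurable_mix c).

(** Both laws agree on rectangles, because the preimage of a rectangle under [mix c] is a product of
    two rectangles. *)
Lemma product_probability_mix c P Q (S : set (n.-tuple Y)) : measurable S ->
  product_probability (fun i => if c i then P i else Q i) S =
  distribution (product_probability P \x product_probability Q) (mix c) S.
Proof.
have rectE P' A : (forall i, measurable (A i)) ->
    product_probability P' (rectangle A) = \prod_(i < n) P' i (A i).
  exact: product_probability_rectangle.
move: S; apply: (measure_unique rectangles (fun=> setT)).
- exact: measurable_tuple_rectangles.
- exact: rectangles_setI.
- by move=> _; exists (fun=> setT) => //; rewrite rectangle_setT.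
- by rewrite bigcup_const.
- move=> _ [A mA ->]; rewrite [LHS]rectE//.
  rewrite /distribution /pushforward /=.
  have -> : mix c @^-1` rectangle A =
      rectangle (fun i => if c i then A i else setT) `*`
      rectangle (fun i => if c i then setT else A i).
    apply/seteqP; split => -[s t] /=.
      by move=> h; split => i /=; have := h i; rewrite tnth_mktuple /=; case: ifP.
    by move=> [h1 h2] i; rewrite tnth_mktuple; have := h1 i; have := h2 i; case: ifP.
  rewrite product_measure1E; try by apply: measurable_rectangle => i; case: ifP.
  rewrite [X in _ = X * _]rectE ?[X in _ = _ * X]rectE; try by move=> i; case: ifP.
  rewrite -big_split; apply: eq_bigr => i _ /=.
  by case: ifP => _; rewrite probability_setT ?mule1 ?mul1e.
- by move=> _; rewrite -ge0_fin_numE// fin_num_measure.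
Qed.

Lemma integral_product_probability_mix c P Q (f : n.-tuple Y -> \bar R) :
  measurable_fun setT f -> (forall t, 0 <= f t) ->
  \int[product_probability (fun i => if c i then P i else Q i)]_t f t =
  \int[product_probability P \x product_probability Q]_p f (mix c p).
Proof.
move=> mf f0.
rewrite (eq_measure_integral (distribution
  (product_probability P \x product_probability Q) (mix c))); last first.
  by move=> S mS _; exact: product_probability_mix.
by rewrite ge0_integral_distribution.
Qed.

End Mixing.

(** * Composition of two private mechanisms *)

Section Composition.
Context (R : realType) (d1 d2 : measure_display).
Context (T1 : measurableType d1) (T2 : measurableType d2).
Local Open Scope ereal_scope.

Lemma product_probability_swap (P : probability T1 R) (Q : probability T2 R) S :
  measurable S -> (P \x Q) S = (P \x^ Q) S.
Proof.
by apply: product_measure_unique => A B mA mB; exact: product_measure2E.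
Qed.

(** Hybrid argument through [P \x Q']: one factor is replaced at a time, by integrating the privacy
    bound over sections. The first [dlt] is paid once, the second is multiplied by [s]. *)
Lemma product_privacy (P P' : probability T1 R) (Q Q' : probability T2 R)
    (s dlt : R) : (0 <= s)%R -> (0 <= dlt)%R ->
  (forall S, measurable S -> P S <= s%:E * P' S + dlt%:E) ->
  (forall S, measurable S -> Q S <= s%:E * Q' S + dlt%:E) ->
  forall S, measurable S ->
    (P \x Q) S <= (s ^+ 2)%:E * (P' \x Q') S + ((1 + s) * dlt)%:E.
Proof.
move=> s0 d0 hP hQ S mS.
have step1 : (P \x Q) S <= s%:E * (P \x Q') S + dlt%:E.
  apply: (@le_trans _ _ (\int[P]_x (s%:E * Q' (xsection S x) + dlt%:E))).
    apply: ge0_le_integral => //.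
    - exact: measurable_fun_xsection.
    - apply: emeasurable_funD => //; apply: measurable_funeM.
      exact: measurable_fun_xsection.
    - by move=> x _; apply: hQ; exact: measurable_xsection.
  rewrite ge0_integralD//; last 2 first.
  - by move=> x _; rewrite mule_ge0.
  - by apply: measurable_funeM; exact: measurable_fun_xsection.
  rewrite integral_cst// [X in _ + _ * X]probability_setT mule1 ge0_integralZl//.
  exact: measurable_fun_xsection.
have step2 : (P \x Q') S <= s%:E * (P' \x Q') S + dlt%:E.
  rewrite !product_probability_swap//.
  apply: (@le_trans _ _ (\int[Q']_y (s%:E * P' (ysection S y) + dlt%:E))).
    apply: ge0_le_integral => //.
    - exact: measurable_fun_ysection.
    - apply: emeasurable_funD => //; apply: measurable_funeM.
      exact: measurable_fun_ysection.
    - by move=> x _; apply: hP; exact: measurable_ysection.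
  rewrite ge0_integralD//; last 2 first.
  - by move=> x _; rewrite mule_ge0.
  - by apply: measurable_funeM; exact: measurable_fun_ysection.
  rewrite integral_cst// [X in _ + _ * X]probability_setT mule1 ge0_integralZl//.
  exact: measurable_fun_ysection.
apply: (le_trans step1).
apply: (@le_trans _ _ (s%:E * (s%:E * (P' \x Q') S + dlt%:E) + dlt%:E)).
  by rewrite leeD2r// lee_wpmul2l.
have [r ->] : exists r, (P' \x Q') S = r%:E.
  pose M : probability (T1 * T2)%type R := (P' \x Q').
  by exists (fine (M S)); rewrite fineK// fin_num_measure.
by rewrite -!(EFinM, EFinD) lee_fin; lra.
Qed.

End Composition.

(** * Events determined by finitely many memberships *)

Section FinitePartition.
Context (R : realType) (d : measure_display) (T : measurableType d).
Local Open Scope ereal_scope.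

(** The event is a finite union of atoms of the algebra generated by the sets [E i]. *)
Lemma measurable_preimage_finType (I J : finType) (E : I -> set T)
    (h : {ffun I -> bool} -> J) (S : pred J) :
  (forall i, measurable (E i)) ->
  measurable [set t | S (h [ffun i => `[< E i t >]])].
Proof.
move=> mE.
have -> : [set t | S (h [ffun i => `[< E i t >]])] =
    \bigcup_(p in [set p : {ffun I -> bool} | S (h p)])
      \bigcap_(i in [set: I]) (if p i then E i else ~` E i).
  apply/seteqP; split => t /=.
    move=> St; exists [ffun i => `[< E i t >]] => // i _.
    by rewrite ffunE; case: asboolP.
  move=> [p /= Sp Ep]; suff -> : [ffun i => `[< E i t >]] = p by [].
  apply/ffunP => i; rewrite ffunE; have := Ep i Logic.I.
  by case: (p i) => /= h1; apply/asboolP.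
apply: fin_bigcup_measurable => // p _; apply: fin_bigcap_measurable => // i _.
by case: (p i) => //; exact: measurableC.
Qed.

Lemma sum_fiber_measure (J : finType) (mu : probability T R) (f : T -> J)
    (S : pred J) :
  (forall j, measurable [set t | f t = j]) ->
  (\sum_(j | S j) fine (mu [set t | f t = j]))%R = fine (mu [set t | S (f t)]).
Proof.
move=> mf.
have -> : [set t | S (f t)] = \bigcup_(j in [set` S]) [set t | f t = j].
  by apply/seteqP; split => t /=; [move=> h; exists (f t)|case=> j /= Sj ->].
rewrite measure_fin_bigcup//; last first.
  by move=> j k _ _ [t [/= <- <-]].
rewrite -(bigfs _ (index_enum_uniq J)); last first.
  by move=> j _; rewrite mem_index_enum.
rewrite [in RHS](eq_bigr (fun j => (fine (mu [set t | f t = j]))%:E)).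
  by rewrite sumEFin.
by move=> j _; rewrite fineK// fin_num_measure.
Qed.

End FinitePartition.

(** * The reconstruction attack *)

(* [loss X q t] is the probability, given the observation [t], that the answer
   to the query [q] is inaccurate for the database [X]. The attack outputs any
   [X] whose average loss is below [p / bet]; by Markov the true database
   qualifies with probability at least [1 - bet], and two qualifying databases
   conflict on at most a fraction [2 p / bet] of the queries. *)
Section Reconstruction.
Context (R : realType) (d : measure_display) (T : measurableType d).
Context (K Q : finType).
Variables (mu : {ffun K -> bool} -> probability T R)
  (loss : {ffun K -> bool} -> Q -> T -> \bar R)
  (conflict : {ffun K -> bool} -> {ffun K -> bool} -> pred Q).
Variables (s dlt p bet g : R).
Hypotheses (K0 : (0 < #|K|)%N) (s0 : 0 <= s) (p0 : 0 < p) (bet0 : 0 < bet)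
  (bet1 : bet <= 1) (g0 : 0 <= g).
Hypothesis mloss : forall X q, measurable_fun setT (loss X q).
Hypothesis loss0 : forall X q t, (0 <= loss X q t)%E.
Hypothesis loss_le : forall X q, (\int[mu X]_t loss X q t <= p%:E)%E.
Hypothesis loss_conflict : forall X Z q t,
  conflict X Z q -> (1 <= loss X q t + loss Z q t)%E.
Hypothesis conflict_often : forall X Z : {ffun K -> bool},
  #|[pred k | X k == Z k]|%:R < g * #|K|%:R ->
  2 * p * #|Q|%:R <= bet * #|[pred q | conflict X Z q]|%:R.
Hypothesis Q0 : (0 < #|Q|)%N.
Hypothesis mu_private : forall X k S, measurable S ->
  (mu X S <= s%:E * mu (flip k X) S + dlt%:E)%E.

Let total X t : \bar R := (\sum_q loss X q t)%E.
Let E X : set T := [set t | (total X t < (p * #|Q|%:R / bet)%:E)%E].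

Let mtotal X : measurable_fun setT (total X).
Proof. exact: emeasurable_sum. Qed.

Let total0 X t : (0 <= total X t)%E.
Proof. exact: sume_ge0. Qed.

Let mE X : measurable (E X).
Proof. by rewrite -[E X]setTI; exact: emeasurable_fun_infty_o. Qed.

Let pQ0 : 0 < p * #|Q|%:R / bet.
Proof. by rewrite divr_gt0 ?mulr_gt0// ltr0n. Qed.

Let mu_E X : 1 - bet <= fine (mu X (E X)).
Proof.
have int_total : (\int[mu X]_t total X t <= (p * #|Q|%:R)%:E)%E.
  rewrite ge0_integral_sum//.
  apply: (@le_trans _ _ (\sum_(q : Q) p%:E)%E); last first.
    by rewrite sumEFin lee_fin sumr_const mulr_natr.
  by apply: lee_sum => q _; exact: loss_le.
have markov_E : ((p * #|Q|%:R / bet)%:E * mu X (~` E X) <= (p * #|Q|%:R)%:E)%E.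
  apply: le_trans int_total.
  rewrite (_ : ~` E X =
      setT `&` [set t | ((p * #|Q|%:R / bet)%:E <= `|total X t|)%E]); last first.
    rewrite setTI; apply/seteqP; split => t /=; rewrite gee0_abs// /E /= leNgt.
      by move/negP.
    by move/negP.
  rewrite (eq_integral (fun t => idfun `|total X t|%E)) => [|t _].
    apply: (@le_integral_comp_abse _ _ _ (mu X) _ _ _ _ idfun) => //.
    exact: measurable_id.
  by rewrite gee0_abs.
move: markov_E; rewrite probability_setC//.
have [r Er] : exists r, mu X (E X) = r%:E.
  by exists (fine (mu X (E X))); rewrite fineK// fin_num_measure.
rewrite Er -EFinB -EFinM lee_fin /= => h.
have : p * #|Q|%:R / bet * (1 - r) <= p * #|Q|%:R / bet * bet.
  by rewrite [leRHS]divfK ?gt_eqF.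
by rewrite ler_pM2l//; lra.
Qed.

(** Every conflict adds at least 1 to [total X t + total Z t], which is below [2 * p * #|Q| / bet];
    too few agreements would force at least that many conflicts. *)
Let E_agree X Z t : E X t -> E Z t ->
  g * #|K|%:R <= #|[pred k | X k == Z k]|%:R.
Proof.
move=> EX EZ; rewrite leNgt; apply/negP => /conflict_often h.
have : ((#|[pred q | conflict X Z q]|%:R)%:E <= total X t + total Z t)%E.
  rewrite /total -big_split /= -sum1_card natr_sum -sumEFin big_mkcond /=.
  apply: lee_sum => q _; case: ifP => [/loss_conflict //|_].
  by rewrite adde_ge0.
apply/negP; rewrite -ltNge.
apply: (@lt_le_trans _ _ ((p * #|Q|%:R / bet)%:E + (p * #|Q|%:R / bet)%:E)%E).
  exact: lteD.
rewrite -EFinD lee_fin -(ler_pM2l bet0); apply: le_trans h.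
have -> : bet * (p * #|Q|%:R / bet + p * #|Q|%:R / bet) = 2 * p * #|Q|%:R.
  by field; rewrite gt_eqF.
exact: lexx.
Qed.

Lemma reconstruction : (1 + s) * ((1 - bet) * g) <= s + dlt.
Proof.
(* The attack reads [t] only through the finite vector of memberships, which makes it measurable.
   The all-false default is an arbitrary output for when no database qualifies. *)
pose h (e : {ffun {ffun K -> bool} -> bool}) : {ffun K -> bool} :=
  odflt [ffun=> false] [pick X | e X].
pose dec t := h [ffun X => `[< E X t >]].
have mdec (S : pred {ffun K -> bool}) : measurable [set t | S (dec t)].
  exact: measurable_preimage_finType.
have mdec1 Z : measurable [set t | dec t = Z].
  have := mdec (pred1 Z); congr measurable.
  by apply/seteqP; split => t /= /eqP.
(* The output may differ from the true database, but it qualifies whenever the true one does, so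
   [E_agree] applies. *)
have decE X t : E X t -> E (dec t) t.
  move=> EX; rewrite /dec /h; case: pickP => [Z|/(_ X)]; rewrite ffunE.
    by move/asboolP.
  by move/asboolP.
apply: (@private_reconstruction_bound R K
  (fun X Z => fine (mu X [set t | dec t = Z]))) => //.
- by rewrite subr_ge0.
- by move=> X Z; rewrite fine_ge0.
- move=> X; rewrite (sum_fiber_measure _ xpredT)//=.
  rewrite (_ : [set t | is_true true] = setT) ?probability_setT//.
  by apply/seteqP; split.
- move=> X k S; rewrite !sum_fiber_measure//.
  have := mu_private X k (mdec S).
  have fin Z : mu Z [set t | S (dec t)] \is a fin_num by rewrite fin_num_measure.
  by rewrite -(fineK (fin X)) -(fineK (fin (flip k X))) -EFinM -EFinD lee_fin.
- move=> X; rewrite sum_fiber_measure//; apply: le_trans (mu_E X) _.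
  rewrite fine_le ?fin_num_measure//; last 2 first.
  exact: (mdec (fun Z => g * #|K|%:R <= #|[pred k | X k == Z k]|%:R)).
  apply: le_measure; rewrite ?inE//.
    exact: (mdec (fun Z => g * #|K|%:R <= #|[pred k | X k == Z k]|%:R)).
  by move=> t EX /=; apply: (E_agree EX); exact: decE EX.
Qed.

End Reconstruction.

(** Used with [S = m^2], [D] the number of agreements and [b] the square of the bilinear form. More
    than [S / 5] disagreements give [S * b > S^2 / 15360], while [4 * alpha^2 < S^2 / 15625]; this
    fixes the constant 250. *)
Lemma disagreement_forces_distance (R : realFieldType) (S D b alpha : R) :
  0 <= D -> D < 4 / 5 * S -> S - D <= 3072 * b ->
  0 <= alpha -> alpha < S / 250 -> ~ S * b <= 2 ^+ 2 * alpha ^+ 2.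
Proof.
move=> D0 differ h alpha0 alpha_small le1.
have S0 : 0 < S by lra.
have le2 : 0 <= (S - 250 * alpha) * (S + 250 * alpha).
  by apply: mulr_ge0; lra.
have lt3 : 0 < S * (3072 * b - S / 5) by apply: mulr_gt0; lra.
have S20 : 0 < S * S by apply: mulr_gt0.
suff : S * S < S * S by rewrite ltxx.
by nra.
Qed.

(** * Answering all queries from two transcripts *)

Section Attack.
Context (R : realType) (d : measure_display) (Y : measurableType d) (n m : nat).
Variables (A : noninteractive_algorithm R Y n)
  (emb : 'I_m + 'I_m + 'I_m -> 'I_n).
Hypothesis emb_inj : injective emb.
Variables (eps delta alpha p : R).
Hypothesis A_private : ledp eps delta A.
Local Notation bits := {ffun 'I_m * 'I_m -> bool}.
Local Notation query := ({ffun 'I_m -> bool} * {ffun 'I_m -> bool})%type.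
Local Notation qgraph X q := (query_graph emb X q.1 q.2).
Hypothesis A_accurate : forall (X : bits) (q : query),
  approximates_triangles A (qgraph X q) alpha (1 - p).

Let none : query := ([ffun=> false], [ffun=> false]).
Let full : query := ([ffun=> true], [ffun=> true]).

(* One copy of the transcript under the full query and one under the empty query
   suffice to simulate the transcript under any query: the outputs of the third
   part do not depend on the database. *)
Definition database_transcript (X : bits) :
    probability (n.-tuple Y * n.-tuple Y)%type R :=
  (transcript A (qgraph X full) \x transcript A (qgraph X none))%E.

(** Averages over the outputs of the third part, resampled on the all-false database: their law
    depends on [q] but not on the secret database. *)
Definition query_integral (q : query) (f : n.-tuple Y -> \bar R)
    (t : n.-tuple Y) : \bar R :=
  (\int[transcript A (qgraph [ffun=> false] q)]_w
    f (mix (in_third_part emb) (w, t)))%E.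

Lemma measurable_query_integral q (f : n.-tuple Y -> \bar R) :
  measurable_fun setT f -> (forall t, (0 <= f t)%E) ->
  measurable_fun setT (query_integral q f).
Proof.
move=> mf f0.
apply: (measurable_fun_fubini_tonelli_G (f \o mix (in_third_part emb))).
  exact: measurableT_comp.
by move=> t; exact: f0.
Qed.

(** Mixing is used twice: first to split off the third part, then, after Fubini, to assemble the
    other outputs from the full and the empty copy. *)
Lemma integral_transcript X q (f : n.-tuple Y -> \bar R) :
  measurable_fun setT f -> (forall t, (0 <= f t)%E) ->
  (\int[transcript A (qgraph X q)]_t f t =
   \int[database_transcript X]_t
     query_integral q f (mix (copy_choice emb q.1 q.2) t))%E.
Proof.
move=> mf f0.
pose P G i : probability Y R := randomizers A i (row i (adjacency_matrix G)).
pose P2 i := if copy_choice emb q.1 q.2 i then P (qgraph X full) i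
             else P (qgraph X none) i.
have -> : transcript A (qgraph X q) = product_probability (fun i =>
    if in_third_part emb i then P (qgraph [ffun=> false] q) i else P2 i).
  rewrite /transcript; congr product_probability; apply/funext => i.
  rewrite row_query_graph /P2 /P.
  by case: (in_third_part emb i); case: (copy_choice emb q.1 q.2 i).
rewrite (integral_product_probability_mix (in_third_part emb) _ P2 mf f0).
rewrite (fubini_tonelli2 (f \o mix (in_third_part emb))); last 2 first.
- exact: measurableT_comp.
- by move=> t; exact: f0.
apply: (integral_product_probability_mix (copy_choice emb q.1 q.2)
  (P (qgraph X full)) (P (qgraph X none)) (measurable_query_integral q mf f0)).
by move=> t; apply: integral_ge0 => w _; exact: f0.
Qed.

Definition accurate_answers X q : set R :=
  [set z | `|z - (triangles (qgraph X q))%:R| <= alpha].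

Lemma measurable_accurate_answers X q :
  measurable (accurate_answers X q : set (measurableTypeR R)).
Proof.
have -> : accurate_answers X q = `[(triangles (qgraph X q))%:R - alpha,
    (triangles (qgraph X q))%:R + alpha]%classic.
  apply/seteqP; split => z; rewrite /accurate_answers /= in_itv /= ler_distl//.
exact: measurable_itv.
Qed.

Definition answer_loss X q (t : n.-tuple Y * n.-tuple Y) : \bar R :=
  query_integral q (fun t => postprocessing A t (~` accurate_answers X q))
    (mix (copy_choice emb q.1 q.2) t).

Let mC X q : measurable (~` accurate_answers X q : set (measurableTypeR R)).
Proof. by apply: measurableC; exact: measurable_accurate_answers. Qed.

Lemma measurable_answer_loss X q : measurable_fun setT (answer_loss X q).
Proof.
apply: measurableT_comp => //; apply: measurable_query_integral => //.
exact: measurable_kernel.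
Qed.

Lemma answer_loss_ge0 X q t : (0 <= answer_loss X q t)%E.
Proof. exact: integral_ge0. Qed.

Lemma postprocessingC t (S : set (measurableTypeR R)) : measurable S ->
  (postprocessing A t S + postprocessing A t (~` S) = 1)%E.
Proof.
move=> mS; rewrite -measureU//; last by rewrite setICr.
  by rewrite setUv; exact: prob_kernel.
exact: measurableC.
Qed.

(** By the simulation identity, the mean loss is exactly the failure probability of [A] on the query
    graph. *)
Lemma integral_answer_loss X q :
  (\int[database_transcript X]_t answer_loss X q t <= p%:E)%E.
Proof.
rewrite -integral_transcript//; last exact: measurable_kernel.
have acc := A_accurate X q.
have : (output_probability A (qgraph X q) (accurate_answers X q) +
  \int[transcript A (qgraph X q)]_t
    postprocessing A t (~` accurate_answers X q) = 1)%E.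
  rewrite /output_probability -ge0_integralD//; last 2 first.
  - by apply: measurable_kernel; exact: measurable_accurate_answers.
  - exact: measurable_kernel.
  rewrite (eq_integral (cst 1%E)) => [|t _].
    by rewrite integral_cst// mul1e; exact: probability_setT.
  by rewrite postprocessingC//; exact: measurable_accurate_answers.
move: acc; rewrite /approximates_triangles -/(accurate_answers X q).
set x := output_probability _ _ _; set y := (\int[_]_t _)%E.
case: x y => [x| |] [y| |] //=.
by rewrite -EFinD !lee_fin => h [] h2; lra.
Qed.

Definition far_answers (X Z : bits) : pred query := fun q =>
  2 * alpha < `|(triangles (qgraph X q))%:R - (triangles (qgraph Z q))%:R : R|.

(** No answer is within [alpha] of two counts more than [2 * alpha] apart, so the two failure events
    cover everything. Both losses average over the same resampled outputs, so the union bound passes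
    through the integral. *)
Lemma answer_loss_far X Z q t :
  far_answers X Z q -> (1 <= answer_loss X q t + answer_loss Z q t)%E.
Proof.
move=> far.
have slice_measurable V : measurable_fun setT (fun w =>
    postprocessing A
      (mix (in_third_part emb) (w, mix (copy_choice emb q.1 q.2) t))
      (~` accurate_answers V q)).
  apply: (measurable_fun_pair1 (f := (fun u => postprocessing A u
    (~` accurate_answers V q)) \o mix (in_third_part emb))).
  by apply: measurableT_comp => //; exact: measurable_kernel.
rewrite /answer_loss /query_integral -ge0_integralD//.
have <- : (\int[transcript A (qgraph [ffun=> false] q)]_w cst 1 w = 1)%E.
  by rewrite integral_cst// mul1e; exact: probability_setT.
apply: ge0_le_integral => //.
  exact: emeasurable_funD.
move=> w _; set u := mix _ (w, _).
have <- : postprocessing A u setT = 1%E by exact: prob_kernel.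
apply: le_trans (measureU2 _ (mC X q) (mC Z q)).
rewrite le_measure ?inE//; first exact: measurableU.
move=> z _; apply/not_andP => -[h1 h2].
move: far; rewrite /far_answers ltNge => /negP; apply.
apply: le_trans (ler_distD z _ _) _.
by rewrite (distrC _ z) mulr_natl mulr2n; exact: lerD h1 h2.
Qed.

Lemma database_transcript_private X k S : 0 <= delta -> measurable S ->
  (database_transcript X S <=
   (expR eps ^+ 2)%:E * database_transcript (flip k X) S
   + ((1 + expR eps) * delta)%:E)%E.
Proof.
move=> delta0; apply: product_privacy => //.
- by apply: A_private; exact: query_graph_neighbor.
- by apply: A_private; exact: query_graph_neighbor.
Qed.

Lemma far_answers_often (X Z : bits) :
  alpha < (m%:R ^+ 2) / 250 ->
  #|[pred k | X k == Z k]|%:R < 4 / 5 * #|{: 'I_m * 'I_m}|%:R :> R ->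
  #|{: query}|%:R <= 1152 * #|far_answers X Z|%:R :> R.
Proof.
move=> alpha_small differ.
pose M u v : R := (X (u, v))%:R - (Z (u, v))%:R.
have -> : #|{: query}|%:R =
    #|{ffun 'I_m -> bool}|%:R * #|{ffun 'I_m -> bool}|%:R :> R.
  by rewrite card_prod natrM.
apply: le_trans (bilinear_anticoncentration M) _.
rewrite ler_wpM2l ?ler0n//.
rewrite exchange_big pair_bigA.
rewrite -sum1_card natr_sum [leRHS]big_mkcond /=.
(* The entries of [M] are in {-1, 0, 1}, so the sum of their squares counts disagreements. *)
have VE : \sum_u \sum_v M u v ^+ 2 =
    #|{: 'I_m * 'I_m}|%:R - #|[pred k | X k == Z k]|%:R.
  rewrite -!sum1_card !natr_sum [in X in _ - X]big_mkcond /= -sumrB.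
  rewrite pair_bigA /=; apply: eq_bigr => -[u v] _; rewrite /M inE /=.
  by case: (X (u, v)) (Z (u, v)) => [] []; rewrite /= ?expr0n; ring.
apply: ler_sum => -[a b] _ /=.
have triE :
    (triangles (qgraph X (a, b)))%:R - (triangles (qgraph Z (a, b)))%:R =
    m%:R * \sum_u (a u)%:R * \sum_v (b v)%:R * M u v :> R.
  rewrite !triangles_query_graph// !natrM -mulrBr; congr (_ * _).
  rewrite !natr_sum -sumrB; apply: eq_bigr => u _.
  rewrite !natr_sum -sumrB mulr_sumr; apply: eq_bigr => v _.
  by rewrite !natrM /M; ring.
have [h|_] := leP (\sum_u \sum_v M u v ^+ 2) _; last by case: ifP.
rewrite /in_mem /= /far_answers triE ifT//.
move: h; set B := \sum_u _ * _; rewrite VE => h.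
rewrite ltNge; apply/negP => B_small.
move: differ h; rewrite card_prod card_ord natrM -expr2.
set D : R := #|_|%:R; set S : R := m%:R ^+ 2 => differ h.
have D0 : 0 <= D by rewrite ler0n.
have mB0 := normr_ge0 (m%:R * B).
(* The sign of [alpha] comes from [2 * alpha] bounding an absolute value. *)
have alpha0 : 0 <= alpha by rewrite -(pmulr_rge0 _ (ltr0Sn R 1)) (le_trans mB0).
have : `|m%:R * B| ^+ 2 <= (2 * alpha) ^+ 2.
  by rewrite lerXn2r ?nnegrE ?mulr_ge0.
rewrite real_normK ?num_real// exprMn -/S exprMn.
exact: disagreement_forces_distance D0 differ h alpha0 alpha_small.
Qed.

End Attack.

(** * Numerical constants and the lower bound *)

(** Contradicts [reconstruction] at [s = e^2], [bet = 1/5], [g = 4/5]. The claim amounts to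
    [9/25 * e^2 + (1 + e) * delta < 16/25]. *)
Lemma privacy_parameters_too_small (R : realFieldType) (e delta : R) :
  0 < e -> e <= 20 / 19 -> 0 <= delta -> delta < 1 / 100 ->
  e ^+ 2 + (1 + e) * delta < (1 + e ^+ 2) * ((1 - 1 / 5) * (4 / 5)).
Proof.
move=> e0 e_le delta0 delta_small.
have : 0 <= (20 / 19 - e) * (20 / 19 + e) by apply: mulr_ge0; lra.
have : 0 <= (1 + e) * (1 / 100 - delta) by apply: mulr_ge0; lra.
by nra.
Qed.

(** As [1152 = 2^7 * 3^2], the product is [2/81]; the bound [1/5] is the parameter [bet] of the
    attack. *)
Lemma success_deficit_bounds (R : realFieldType)
    (p := 1 / (3 ^+ 6 * 2 ^+ 7) : R) :
  0 < p /\ 2 * p * 1152 <= 1 / 5.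
Proof.
have -> : p = 1 / 729 / 128.
  rewrite /p -mulrA -invfM; congr (1 / (_ * _)); ring.
by split; lra.
Qed.

Lemma third_bounds n : (6 <= n)%N ->
  [/\ (0 < n %/ 3)%N, (n <= 4 * (n %/ 3))%N & (3 * (n %/ 3) <= n)%N].
Proof. by split; lia. Qed.

Lemma expR_small_le (R : realType) (eps : R) :
  eps < 1 / 20 -> expR eps <= 20 / 19.
Proof.
(* From [1 - eps <= expR (- eps)] follows [expR eps <= 1 / (1 - eps)]. *)
move=> eps_small; have := expR_ge1Dx (- eps); rewrite expRN => h.
have e0 := expR_gt0 eps.
have : (1 - eps) * expR eps <= 1.
  by rewrite -[leRHS](@mulVf _ (expR eps)) ?gt_eqF// ler_wpM2r// ltW.
by nra.
Qed.

Theorem theorem3p1 (R : realType) :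
  exists F : forall n : nat, set (graph n),
  exists (c : R) (N : nat), 0 < c /\
  forall (eps delta : R),
    0 < eps -> eps < 1 / 20 -> 0 <= delta -> delta < 1 / 100 ->
  forall (n : nat), (N <= n)%N ->
  forall (d : measure_display) (Y : measurableType d)
    (A : noninteractive_algorithm R Y n) (alpha : R),
    ledp eps delta A ->
    (forall G : graph n, F n G ->
       approximates_triangles A G alpha (1 - 1 / (3 ^+ 6 * 2 ^+ 7))) ->
  c * n%:R ^+ 2 <= alpha.
Proof.
exists (fun n => [set G | exists
  (emb : 'I_(n %/ 3) + 'I_(n %/ 3) + 'I_(n %/ 3) -> 'I_n) X a b,
  injective emb /\ G = query_graph emb X a b]).
(* From [n = 6] on, [n <= 4 * (n %/ 3)], so [n^2 / 4000 <= m^2 / 250], the accuracy that the attack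
   requires. *)
exists (1 / 4000), 6%N; split; first by rewrite divr_gt0 ?ltr0n.
move=> eps delta eps0 eps_small delta0 delta_small n n6 d Y A alpha.
move=> A_private accurate.
rewrite leNgt; apply/negP => alpha_small.
have [m_pos n_le m_le] := third_bounds n6.
set m := (n %/ 3)%N in m_pos n_le m_le accurate.
have [emb emb_inj] := exists_role_embedding m_le.
have alpha_lt : alpha < m%:R ^+ 2 / 250.
  apply: lt_le_trans alpha_small _.
  have : n%:R <= 4 * m%:R :> R by rewrite -natrM ler_nat.
  move: (ler0n R n) (ler0n R m); move: (n%:R : R) (m%:R : R) => x y.
  by clear; nra.
have := success_deficit_bounds R; set p : R := 1 / (3 ^+ 6 * 2 ^+ 7) in accurate *.
clearbody p; cbv zeta => -[p_gt0 p_le].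
have acc X q : approximates_triangles A (query_graph emb X q.1 q.2) alpha (1 - p).
  by apply: accurate; exists emb, X, q.1, q.2.
have e_le := expR_small_le eps_small; have e_gt := expR_gt0 eps.
(* With [bet = 1/5], the fraction [1/1152] of far queries exceeds the conflict threshold
   [2 * p / bet]. *)
have often (X Z : {ffun 'I_m * 'I_m -> bool}) :
    #|[pred k | X k == Z k]|%:R < 4 / 5 * #|{: 'I_m * 'I_m}|%:R :> R ->
    2 * p * #|{: {ffun 'I_m -> bool} * {ffun 'I_m -> bool}}|%:R <=
    1 / 5 * #|[pred q | far_answers emb alpha X Z q]|%:R.
  move=> /(far_answers_often emb_inj alpha_lt) le_card.
  have p2 : 0 <= 2 * p by rewrite mulr_ge0 ?ler0n// ltW.
  apply: le_trans (ler_wpM2l p2 le_card) _.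
  by rewrite mulrA ler_wpM2r ?ler0n.
have := reconstruction (mu := database_transcript A emb)
  (loss := answer_loss A emb alpha) (conflict := far_answers emb alpha)
  (s := expR eps ^+ 2) (dlt := (1 + expR eps) * delta) (p := p)
  (bet := 1 / 5) (g := 4 / 5).
have K_pos : (0 < #|{: 'I_m * 'I_m}|)%N.
  by rewrite card_prod card_ord muln_gt0 m_pos.
have Q_pos : (0 < #|{: {ffun 'I_m -> bool} * {ffun 'I_m -> bool}}|)%N.
  by apply/card_gt0P; exists ([ffun=> false], [ffun=> false]).
have [bet0 bet1 g0] : [/\ 0 < 1 / 5 :> R, 1 / 5 <= 1 :> R & 0 <= 4 / 5 :> R].
  by split; lra.
move=> /(_ K_pos (sqr_ge0 _) p_gt0 bet0 bet1 g0
  (measurable_answer_loss _ _ _) (answer_loss_ge0 _ _ _)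
  (integral_answer_loss acc) (fun _ _ _ t => answer_loss_far A t) often Q_pos
  (fun X k S => database_transcript_private emb_inj A_private X k delta0)).
by apply/negP; rewrite -ltNge; exact: privacy_parameters_too_small.
Qed.
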